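(* Let $K$ and $L$ be simplicial complexes on disjoint finite index sets $V$ and $W$, respectively. If $K\neq\Delta^V$ and $L\neq\Delta^W$, then the Alexander dual $(K*L)^*$ (taken with respect to the index set $V\sqcup W$) is Golod.
   Context: A simplicial complex $K$ on a finite index set $V$ is a family of subsets of $V$ closed under taking subsets and containing $\emptyset$; elements of $V$ that are not vertices of $K$ (ghost vertices) are allowed. $\Delta^V$ is the full simplex on $V$. The join of complexes on disjoint index sets $V,W$ is $K*L=\{\sigma\sqcup\tau\subset V\sqcup W\mid\sigma\in K,\tau\in L\}$. The Alexander dual of $K\ne\Delta^V$ is $K^*=\{\sigma\subset V\mid V\setminus\sigma\notin K\}$. Golod: for a complex $K$ on $[m]=\{1,\dots,m\}$ and a field $\mathbf{k}$, let $\mathbf{k}[K]=\mathbf{k}[v_1,\dots,v_m]/(v_{i_1}\cdots v_{i_k}\mid\{i_1,\dots,i_k\}\notin K)$ and let $\mathrm{Tor}^{\mathbf{k}[v_1,\dots,v_m]}(\mathbf{k}[K],\mathbf{k})=H(\Lambda[u_1,\dots,u_m]\otimes\mathbf{k}[K],d)$ be the homology of the Koszul differential graded algebra with $\deg u_i=(1,2)$, $\deg v_i=(0,2)$, $du_i=v_i$, $dv_i=0$. $K$ is Golod over $\mathbf{k}$ if the multiplication (of elements of positive degree) and all higher Massey products in this algebra are trivial; $K$ is Golod if it is Golod over every field. Massey products: write $\bar a=(-1)^{\deg a+1}a$. The $n$-fold Massey product $\langle a_1,\dots,a_n\rangle$ is the set of homology classes of elements $\bar a_{1,1}a_{2,n}+\bar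 a_{1,2}a_{3,n}+\cdots+\bar a_{1,n-1}a_{n,n}$ over all solutions of $a_i=[a_{i,i}]$ for $1\le i\le n$ and $da_{i,j}=\bar a_{i,i}a_{i+1,j}+\cdots+\bar a_{i,j-1}a_{j,j}$ for $1\le i<j\le n$, $(i,j)\ne(1,n)$. It is trivial if it contains zero. *)

(* Defs.v *)
From HB Require Import structures.
From mathcomp Require Import all_boot all_order all_algebra ring_quotient.
From mathcomp Require Import boolp.
From mathcomp Require Import mpoly.

Set Implicit Arguments.
Unset Strict Implicit.
Unset Printing Implicit Defensive.

Import GRing.Theory.
Local Open Scope ring_scope.
Local Open Scope quotient_scope.

Definition is_scomplex (V : finType) (K : {set {set V}}) : bool :=
  (set0 \in K) && [forall s in K, forall t : {set V}, (t \subset s) ==> (t \in K)].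

(* Singletons are not required to be faces, so ghost vertices are allowed. *)
Record scomplex (V : finType) :=
  Scomplex { faces :> {set {set V}}; facesP : is_scomplex faces }.

HB.instance Definition _ (V : finType) := [isSub for @faces V].
HB.instance Definition _ (V : finType) := [Equality of scomplex V by <:].

Lemma is_scomplexP (V : finType) (K : {set {set V}}) :
  reflect (set0 \in K /\
           forall s t : {set V}, s \in K -> t \subset s -> t \in K)
          (is_scomplex K).
Proof.
apply: (iffP andP) => [[K0 /forall_inP H]|[K0 H]]; split=> //.
  by move=> s t sK ts; move/forallP/(_ t)/implyP: (H s sK); apply.
by apply/forall_inP=> s sK; apply/forallP=> t; apply/implyP; apply: H sK.
Qed.

Lemma scomplex0 (V : finType) (K : scomplex V) : set0 \in faces K.
Proof. by case/is_scomplexP: (facesP K). Qed.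

Lemma scomplexS (V : finType) (K : scomplex V) (s t : {set V}) :
  s \in faces K -> t \subset s -> t \in faces K.
Proof. by case/is_scomplexP: (facesP K) => _; apply. Qed.

Lemma simplex_subproof (V : finType) : is_scomplex [set: {set V}].
Proof. by apply/is_scomplexP; split=> *; rewrite inE. Qed.

Definition simplex (V : finType) : scomplex V := Scomplex (simplex_subproof V).

Lemma neq_simplex (V : finType) (K : scomplex V) :
  (K != simplex V) = (setT \notin faces K).
Proof.
congr (~~ _); apply/eqP/idP => [->|KT]; first by rewrite inE.
by apply/val_inj/setP=> s; rewrite [RHS]inE (scomplexS KT) ?subsetT.
Qed.

Definition join_faces (V W : finType) (K : {set {set V}}) (L : {set {set W}}) :
    {set {set V + W}} :=
  [set (inl @: s) :|: (inr @: t) | s : {set V} in K, t : {set W} in L].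

Lemma in_join_faces (V W : finType) (K : {set {set V}}) (L : {set {set W}})
    (s : {set V + W}) :
  (s \in join_faces K L) = (inl @^-1: s \in K) && (inr @^-1: s \in L).
Proof.
apply/imset2P/andP => [[a b aK bL ->]|[aK bL]].
  suff [-> ->] : inl @^-1: ((inl @: a) :|: (inr @: b) : {set V + W}) = a /\
     inr @^-1: ((inl @: a) :|: (inr @: b) : {set V + W}) = b by [].
  split; apply/setP=> x; rewrite !inE mem_imset; try by move=> ? ? [].
    by case: imsetP => [[? _ //]|_]; rewrite orbF.
  by case: imsetP => [[? _ //]|_].
exists (inl @^-1: s) (inr @^-1: s) => //; apply/setP=> -[x|y]; rewrite !inE.
  rewrite mem_imset ?inE; last by move=> ? ? [].
  by case: imsetP => [[? _ //]|_]; rewrite orbF.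
rewrite [X in _ || X]mem_imset ?inE; last by move=> ? ? [].
by case: imsetP => [[? _ //]|_].
Qed.

Lemma join_subproof (V W : finType) (K : scomplex V) (L : scomplex W) :
  is_scomplex (join_faces K L).
Proof.
apply/is_scomplexP; split=> [|s t].
  by rewrite in_join_faces !preimset0 !scomplex0.
rewrite !in_join_faces => /andP[sK sL] ts.
by rewrite (scomplexS sK) ?(scomplexS sL) ?preimsetS.
Qed.

Definition join (V W : finType) (K : scomplex V) (L : scomplex W) :
  scomplex (V + W)%type := Scomplex (join_subproof K L).

Lemma join_neq_simplex (V W : finType) (K : scomplex V) (L : scomplex W) :
  K != simplex V -> L != simplex W -> join K L != simplex (V + W)%type.
Proof. by rewrite !neq_simplex in_join_faces !preimsetT => /negPf->. Qed.

Lemma alexander_dual_subproof (V : finType) (K : scomplex V) :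
  K != simplex V -> is_scomplex [set s : {set V} | ~: s \notin faces K].
Proof.
rewrite neq_simplex => KT; apply/is_scomplexP; split=> [|s t].
  by rewrite inE setC0.
rewrite !inE => sK ts; apply: contra sK => tK.
by rewrite (scomplexS tK) // setCS.
Qed.

Definition alexander_dual (V : finType) (K : scomplex V)
    (hK : K != simplex V) : scomplex V :=
  Scomplex (alexander_dual_subproof hK).

(* An arbitrary finite index set V is identified with [m], m = #|V|, through
   enum_rank; this orders V and labels the polynomial variables. *)
Section StanleyReisner.
Variables (k : fieldType) (V : finType).

Definition srX (i : V) : {mpoly k[#|V|]} := 'X_(enum_rank i).

Definition sr_gen (s : {set V}) : {mpoly k[#|V|]} := \prod_(i in s) srX i.

(* The ideal generated by the monomials of the non-faces of K. *)
Definition sr_ideal (K : scomplex V) (f : {mpoly k[#|V|]}) : bool :=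
  `[< exists c : {set V} -> {mpoly k[#|V|]},
        f = \sum_(s : {set V} | s \notin faces K) c s * sr_gen s >].

Lemma sr_ideal_closed (K : scomplex V) : idealr_closed (sr_ideal K).
Proof.
split.
- by apply/asboolP; exists (fun=> 0); rewrite big1 // => s _; rewrite mul0r.
- apply/negP=> /asboolP[c] /(congr1 (meval (fun=> 0))) /eqP.
  rewrite meval1 raddf_sum big1 ?oner_eq0 // => s sK /=.
  have /set0Pn[i si] : s != set0 by apply: contra sK => /eqP->; exact: scomplex0.
  by rewrite /sr_gen (big_setD1 i) //= !mevalM mevalXU mul0r mulr0.
- move=> a f g /asboolP[c ->] /asboolP[c' ->]; apply/asboolP.
  exists (fun s => a * c s + c' s); rewrite mulr_sumr -big_split /=.
  by apply: eq_bigr => s _; rewrite mulrDl mulrA.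
Qed.

HB.instance Definition _ (K : scomplex V) :=
  isIdealr.Build {mpoly k[#|V|]} (sr_ideal K) (sr_ideal_closed K).

Definition sr_ring (K : scomplex V) :=
  {ideal_quot (sr_ideal K : idealr {mpoly k[#|V|]})}.

HB.instance Definition _ (K : scomplex V) := GRing.ComNzRing.on (sr_ring K).

Definition sr_proj (K : scomplex V) : {rmorphism {mpoly k[#|V|]} -> sr_ring K} :=
  \pi_({ideal_quot (sr_ideal K : idealr {mpoly k[#|V|]})}).

End StanleyReisner.

(* The Koszul algebra Lambda[u_i | i : V] (x) R over a commutative ring R with
   elements v i, as a free R-module on the basis u_S, S a subset of V, where u_S
   is the product of the u_i, i in S, in increasing order of enum_rank: the
   element x stands for the sum of the u_S (x) x S. *)
Section Koszul.
Variables (V : finType) (R : comNzRingType) (v : V -> R).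

Definition koszul := {ffun {set V} -> R}.
HB.instance Definition _ := GRing.Zmodule.on koszul.

(* For disjoint S and T, u_S u_T = (-1) ^+ inv S T u_(S :|: T). *)
Definition inv (S T : {set V}) : nat :=
  #|[set ij : V * V | [&& ij.1 \in S, ij.2 \in T
                        & (enum_rank ij.2 < enum_rank ij.1)%N]]|.

Definition kmul (x y : koszul) : koszul :=
  [ffun U : {set V} => \sum_(S : {set V} | S \subset U)
     (-1) ^+ inv S (U :\: S) * (x S * y (U :\: S))].

(* The coefficient at u_T of the R-linear antiderivation with d u_i = v i:
   only the sets i |: T contribute, and u_(i |: T) = (-1) ^+ inv [set i] T u_i u_T. *)
Definition kdiff (x : koszul) : koszul :=
  [ffun T : {set V} => \sum_(i : V | i \notin T)
     (-1) ^+ inv [set i] T * (v i * x (i |: T))].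

(* The map a |-> (-1)^(deg a + 1) a; the parity of the total degree is that of
   the exterior degree, since the second degree is always even. *)
Definition kbar (x : koszul) : koszul :=
  [ffun S : {set V} => (-1) ^+ #|S|.+1 * x S].

(* Equality of homology classes, for cycles x and y. *)
Definition homologous (x y : koszul) : Prop := exists w : koszul, x - y = kdiff w.

End Koszul.

Section Golod.
Variables (k : fieldType) (V : finType) (K : scomplex V).

Definition srx (i : V) : sr_ring k K := sr_proj k K (srX k i).

Local Notation A := (koszul V (sr_ring k K)).
Local Notation d := (kdiff srx).

(* x is homogeneous of bidegree (p, r), where deg u_i = (1, 2), deg v_i = (0, 2). *)
Definition kbideg (p r : nat) (x : A) : Prop :=
  forall S : {set V}, exists2 f : {mpoly k[#|V|]}, x S = sr_proj k K f &
    forall m, m \in msupp f -> #|S| = p /\ (2 * (#|S| + mdeg m))%N = r.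

(* z is a cycle of positive degree, representing a homology class. *)
Definition pos_cycle (p r : nat) (z : A) : Prop :=
  [/\ kbideg p r z, (0 < p + r)%N & d z = 0].

(* The class of x lies in <[z 1], ..., [z n]>, z i being a cycle of bidegree
   (p i, r i). The bidegrees asked of the a i j are those that the equations
   impose: multiplication is additive and d has bidegree (-1, 0). *)
Definition massey_product (n : nat) (p r : nat -> nat) (z : nat -> A) (x : A)
    : Prop :=
  exists a : nat -> nat -> A,
  [/\ forall i, (1 <= i <= n)%N -> d (a i i) = 0 /\ homologous srx (a i i) (z i),
      forall i j, (1 <= i <= j)%N -> (j <= n)%N -> (i, j) != (1%N, n) ->
        kbideg ((\sum_(i <= l < j.+1) p l) + (j - i))%N
               (\sum_(i <= l < j.+1) r l)%N (a i j),
      forall i j, (1 <= i < j)%N -> (j <= n)%N -> (i, j) != (1%N, n) ->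
        d (a i j) = \sum_(i <= l < j) kmul (kbar (a i l)) (a l.+1 j)
    & homologous srx (\sum_(1 <= l < n) kmul (kbar (a 1%N l)) (a l.+1 n)) x].

(* A Massey product is trivial if it contains zero; in particular an empty one
   is not trivial. *)
Definition golod_over : Prop :=
  (forall (p r p' r' : nat) (x y : A),
     pos_cycle p r x -> pos_cycle p' r' y -> homologous srx (kmul x y) 0) /\
  (forall (n : nat) (p r : nat -> nat) (z : nat -> A),
     (2 < n)%N ->
     (forall i, (1 <= i <= n)%N -> pos_cycle (p i) (r i) (z i)) ->
     massey_product n p r z 0).

End Golod.

Definition golod (V : finType) (K : scomplex V) : Prop :=
  forall k : fieldType, golod_over k K.

(* Main.v *)
Require Import Defs.
From mathcomp Require Import all_boot.
From mathcomp Require Import ssralg ring_quotient boolp mpoly.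

(** Let M be the dual of K * L.  A set u is a non-face of M exactly when it
    contains the complement of a face of K and the complement of a face of L.
    So the Stanley-Reisner ideal of M is a product I J, where I is generated by
    monomials in the variables of V, J by monomials in the variables of W, and
    both are proper because K and L are not simplices.

    The point is that every cycle of positive degree in the Koszul algebra of
    S / I J (S the polynomial ring) is homologous to a cycle with coefficients
    in I, and also to one with coefficients in J
    ([coef_in_representative]).  Granted this, take representatives of the
    classes of a Massey product with coefficients alternately in I and in J:
    consecutive ones multiply to zero on the nose, so a_(i,j) = 0 for i < j is
    a defining system whose value is 0.  A product of two classes is treated in
    the same way, using the Leibniz rule [kdiff_mul].  This is
    [golod_product_ideal].

    To move a cycle into I, lift it to an element y of the Koszul complex of S.
    That complex is multigraded, and in a multidegree where the variable j
    occurs, the division by x_j followed by the multiplication by u_j is a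
    contraction.  Choose such a j in each nonzero multidegree, in W as soon as
    some variable of W occurs; these contractions add up to an operator H with
    d H + H d = 1 away from multidegree 0 ([kcontract_homotopy]).  So
    y - d H y = H d y in positive degrees.  Here d y has coefficients in I J.
    Every monomial of I J involves a variable of W, so H divides it by a
    variable of W, and it remains in I. *)

Set Implicit Arguments.
Unset Strict Implicit.
Unset Printing Implicit Defensive.

(* Imported once more so that [inv] counts inversions, and is not the inverse
   of a group. *)
Import Defs.
Import GRing.Theory.
Local Open Scope ring_scope.
Local Open Scope quotient_scope.

(** * Inversion numbers and signed sums over subsets *)

Section Signs.
Variable T : finType.
Implicit Types (i j : T) (S U : {set T}).

Lemma inv_sum S U :
  inv S U = (\sum_(i in S) \sum_(j in U) (enum_rank j < enum_rank i : nat))%N.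
Proof.
rewrite /inv -sum1_card.
rewrite (eq_bigr (fun i => \sum_(j in U | (enum_rank j < enum_rank i)%N) 1))%N.
  rewrite pair_big_dep /=; apply: eq_bigl => -[i j]; by rewrite inE.
by move=> i _; rewrite big_mkcondr /=; apply: eq_bigr => j _; case: ifP.
Qed.

Lemma inv_setU1l i S U :
  i \notin S -> inv (i |: S) U = (inv [set i] U + inv S U)%N.
Proof. by move=> iS; rewrite !inv_sum big_setU1 //= big_set1. Qed.

Lemma inv_setU1r i S U :
  i \notin U -> inv S (i |: U) = (inv S [set i] + inv S U)%N.
Proof.
move=> iU; rewrite !inv_sum -big_split /=.
by apply: eq_bigr => j _; rewrite big_setU1 //= big_set1.
Qed.

Lemma inv_set1_subset i S U :
  S \subset U -> inv [set i] U = (inv [set i] S + inv [set i] (U :\: S))%N.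
Proof.
by move=> SU; rewrite !inv_sum !big_set1 (big_setID S) /= (setIidPr SU).
Qed.

Lemma inv1C i j : i != j -> (inv [set i] [set j] + inv [set j] [set i] = 1)%N.
Proof.
move=> ij; rewrite !inv_sum !big_set1.
have: enum_rank i != enum_rank j by rewrite (inj_eq enum_rank_inj).
by rewrite -val_eqE /=; case: ltngtP.
Qed.

Lemma inv_set1C i S :
  i \notin S -> (inv [set i] S + inv S [set i] = #|S|)%N.
Proof.
move=> iS; rewrite !inv_sum big_set1 -big_split -[RHS]sum1_card /=.
apply: eq_bigr => j jS; rewrite big_set1 -(@inv1C i j) ?inv_sum ?big_set1 //.
by apply: contraNneq iS => ->.
Qed.

Lemma sum_subset_mem (G : nmodType) i U (F : {set T} -> G) : i \in U ->
  \sum_(S : {set T} | (S \subset U) && (i \in S)) F S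
    = \sum_(S : {set T} | S \subset U :\ i) F (i |: S).
Proof.
move=> iU; rewrite (reindex_onto (fun S => i |: S) (fun S => S :\ i)) /=.
  apply: eq_bigl => S; rewrite setU11 andbT subUset sub1set iU subsetD1 /=.
  congr (_ && _); apply/eqP/idP => [<-|/setU1K //]; by rewrite !inE eqxx.
by move=> S /andP[_ iS]; rewrite setD1K.
Qed.

(** The terms with [j] before [i] cancel those with [j] after [i]. The diagonal
    is left out because in characteristic 2 antisymmetry says nothing about it. *)
Lemma sum_antisym (G : zmodType) (P : pred T) (F : T -> T -> G) :
    (forall i j, i != j -> F i j = - F j i) ->
  \sum_(i | P i) \sum_(j | P j && (j != i)) F i j = 0.
Proof.
move=> Fa; pose lt i j := (enum_rank i < enum_rank j)%N.
have ltN i j : j != i -> lt i j = ~~ lt j i.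
  rewrite -(inj_eq enum_rank_inj) -val_eqE /lt /=; by case: ltngtP.
transitivity (\sum_(i | P i) \sum_(j | P j && lt i j) F i j +
              \sum_(i | P i) \sum_(j | P j && lt j i) F i j).
  rewrite -big_split; apply: eq_bigr => i _ /=.
  rewrite (bigID (lt i)) /=; congr (_ + _); apply: eq_bigl => j;
    case: eqVneq => [->|ij]; rewrite ?/lt ?ltnn ?andbF ?andbT //.
  by rewrite -!/(lt _ _) (ltN j i) // eq_sym.
rewrite [X in _ + X](exchange_big_dep P) /=; last by move=> i j _ /andP[].
rewrite -big_split big1 // => i Pi /=.
under [X in _ + X]eq_bigl do rewrite Pi /=.
rewrite -big_split big1 //= => j /andP[_ ij]; rewrite Fa ?addNr //.
by apply: contraTneq ij => ->; rewrite /lt ltnn.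
Qed.

End Signs.

(** * The Leibniz rule in the Koszul algebra *)

Section KoszulAlgebra.
Variables (T : finType) (R : comNzRingType) (v : T -> R).
Implicit Types (i j : T) (S U : {set T}) (x y z : koszul T R).
Local Notation d := (kdiff v).

Lemma signrN_odd (m n : nat) :
  odd (m + n) -> (-1) ^+ m = - (-1) ^+ n :> R.
Proof.
rewrite oddD -[in LHS]signr_odd -[in RHS]signr_odd.
by case: (odd m) (odd n) => -[] //= _; rewrite ?expr1 ?expr0 ?opprK.
Qed.

Lemma signr_even (m n : nat) :
  ~~ odd (m + n) -> (-1) ^+ m = (-1) ^+ n :> R.
Proof.
rewrite oddD -[in LHS]signr_odd -[in RHS]signr_odd.
by case: (odd m) (odd n) => -[].
Qed.

Lemma kdiffB x y : d (x - y) = d x - d y.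
Proof.
apply/ffunP=> U; rewrite !ffunE -sumrB; apply: eq_bigr => i _.
by rewrite !ffunE !mulrBr.
Qed.

Lemma kdiff0 : d 0 = 0.
Proof. by rewrite -[in LHS](subrr 0) kdiffB subrr. Qed.

Lemma kdiffN x : d (- x) = - d x.
Proof. by rewrite -[in LHS]sub0r kdiffB kdiff0 sub0r. Qed.

Lemma kmulBl x y z : kmul (x - y) z = kmul x z - kmul y z.
Proof.
apply/ffunP=> U; rewrite !ffunE -sumrB; apply: eq_bigr => S _.
by rewrite !ffunE mulrBl mulrBr.
Qed.

Lemma kmulBr x y z : kmul x (y - z) = kmul x y - kmul x z.
Proof.
apply/ffunP=> U; rewrite !ffunE -sumrB; apply: eq_bigr => S _.
by rewrite !ffunE !mulrBr.
Qed.

Lemma kmul0l x : kmul 0 x = 0.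
Proof. by rewrite -[in LHS](subrr 0) kmulBl subrr. Qed.

Lemma kmul0r x : kmul x 0 = 0.
Proof. by rewrite -[in LHS](subrr 0) kmulBr subrr. Qed.

Lemma kbar0 : kbar (0 : koszul T R) = 0.
Proof. by apply/ffunP=> S; rewrite !ffunE mulr0. Qed.

Lemma kbarK x : kbar (kbar x) = x.
Proof. by apply/ffunP=> S; rewrite !ffunE signrMK. Qed.

Lemma kdiff_bar x : d (kbar x) = - kbar (d x).
Proof.
apply/ffunP=> S; rewrite !ffunE mulr_sumr -sumrN; apply: eq_bigr => i iS.
rewrite !ffunE cardsU1 iS add1n [in LHS]exprS mulN1r !mulNr !mulrN.
by congr (- _); rewrite !mulrA -!exprD; congr (_ * _); rewrite mulrAC -exprD addnC.
Qed.

Lemma kdiffK x : d (d x) = 0.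
Proof.
apply/ffunP=> U; rewrite !ffunE.
pose F i j := (-1) ^+ (inv [set i] U + inv [set j] U + inv [set j] [set i]) *
              (v i * (v j * x (j |: (i |: U)))).
rewrite -[RHS](@sum_antisym _ _ [predC U] F) => [|i j ij]; last first.
  rewrite /F setUCA [v i * _]mulrCA -mulNr; congr (_ * _); apply: signrN_odd.
  have /(congr1 odd) := inv1C ij; rewrite /= !oddD.
  by do 4!case: (odd _).
apply: eq_bigr => i iU; rewrite ffunE !mulr_sumr.
apply: eq_big => [j|j jU]; first by rewrite !inE negb_or andbC.
rewrite /F inv_setU1r // addnAC -addnA !exprD -!mulrA.
by congr (_ * _); rewrite mulrCA; congr (_ * _); rewrite mulrCA.
Qed.

(** Besides the expected terms, the right-hand side contains those in which u_i
    divides a component u_S of x and one of y, whose product is 0. They occur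
    twice, according to the factor from which d removes u_i. Moving u_i across
    the |S| - 1 other factors of u_S gives all of the sign (-1)^|S| of the
    second product except for one -1, so they cancel. *)
Lemma kdiff_mul x y : d (kmul x y) = kmul (d x) y - kmul (kbar x) (d y).
Proof.
apply/ffunP=> U; rewrite [RHS]ffunE [X in _ = _ + X]ffunE.
pose F1 S i := (-1) ^+ (inv S (U :\: S) + inv [set i] S) *
               (v i * x (i |: S) * y (U :\: S)).
pose F2 S i := (-1) ^+ (inv S (U :\: S) + #|S| + inv [set i] (U :\: S)) *
               (v i * x S * y (i |: (U :\: S))).
have E1 : kmul (d x) y U =
    \sum_(S : {set T} | S \subset U) \sum_(i | i \notin S) F1 S i.
  rewrite ffunE; apply: eq_bigr => S SU; rewrite ffunE mulr_suml mulr_sumr.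
  by apply: eq_bigr => i iS; rewrite /F1 exprD -!mulrA.
have E2 : - kmul (kbar x) (d y) U =
    \sum_(S : {set T} | S \subset U) \sum_(i | i \notin U :\: S) F2 S i.
  rewrite ffunE -sumrN; apply: eq_bigr => S SU; rewrite !ffunE !mulr_sumr -sumrN.
  apply: eq_bigr => i iS; rewrite /F2 exprS mulN1r !mulNr mulrN opprK !exprD -!mulrA.
  congr (_ * (_ * _)).
  by rewrite mulrCA; congr (_ * _); rewrite mulrCA.
(* Here u_i divides both factors, and d removes it from x in F1, from y in F2:
   the term of F1 at S is opposite to that of F2 at i |: S. *)
have cancel12 : \sum_(S : {set T} | S \subset U) \sum_(i in U :\: S) F1 S i +
    \sum_(S : {set T} | S \subset U) \sum_(i in S) F2 S i = 0.
  rewrite (exchange_big_dep (mem U)) /=; last by move=> S i _; rewrite inE => /andP[].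
  rewrite [X in _ + X](exchange_big_dep (mem U)) /=; last first.
    by move=> S i /subsetP SU; apply: SU.
  rewrite -big_split big1 //= => i iU.
  rewrite sum_subset_mem //.
  rewrite (eq_bigl (fun S : {set T} => S \subset U :\ i)); last first.
    by move=> S; rewrite subsetD1 inE iU andbT.
  rewrite -big_split big1 //= => S; rewrite subsetD1 => /andP[SU iS].
  have UE : U :\: S = i |: (U :\: (i |: S)).
    by rewrite [i |: S]setUC -setDDl setD1K // inE iU iS.
  have iQ : i \notin U :\: (i |: S) by rewrite !inE eqxx.
  rewrite /F1 /F2 -UE; apply/eqP; rewrite addr_eq0 -mulNr; apply/eqP.
  congr (_ * _); apply: signrN_odd.
  rewrite {1}UE inv_setU1r // inv_setU1l // cardsU1 iS -(inv_set1C iS) !oddD.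
  by do 4!case: (odd _).
have split_in S G : S \subset U -> \sum_(i | i \notin S) G i =
    \sum_(i in U :\: S) G i + \sum_(i | i \notin U) G i :> R.
  move=> SU; rewrite (bigID (mem U)) /=; congr (_ + _); apply: eq_bigl => i.
    by rewrite !inE.
  by rewrite andb_idl //; apply: contra; apply: (subsetP SU).
have split_out S G : S \subset U -> \sum_(i | i \notin U :\: S) G i =
    \sum_(i in S) G i + \sum_(i | i \notin U) G i :> R.
  move=> SU; rewrite (bigID (mem S)) /=; congr (_ + _); apply: eq_bigl => i.
    by rewrite !inE; case: (i \in S); rewrite ?andbT ?andbF.
  rewrite !inE; case: (boolP (i \in S)) => [/(subsetP SU)->|_]; last exact: andbT.
  by rewrite andbF.
rewrite E1 E2 ffunE {E1 E2}.
rewrite (eq_bigr _ (fun S SU => split_in S _ SU)) big_split /=.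
rewrite [X in _ = _ + X](eq_bigr _ (fun S SU => split_out S _ SU)) big_split /=.
rewrite addrACA cancel12 add0r.
rewrite exchange_big [X in _ = _ + X]exchange_big -big_split /=.
apply: eq_bigr => i iU; rewrite ffunE (bigID (fun S : {set T} => i \in S)) /=.
rewrite sum_subset_mem ?setU11 // setU1K // !(mulrDr, mulr_sumr); congr (_ + _).
  apply: eq_bigr => S SU; have iS := contra (subsetP SU i) iU.
  have -> : (i |: U) :\: (i |: S) = U :\: S.
    by rewrite -setDDl setU1K.
  rewrite [v i * _]mulrCA [LHS]mulrA -exprD /F1 /F2 -!mulrA.
  congr (_ * _); apply: signr_even.
  rewrite inv_setU1l // (inv_set1_subset i SU) !oddD.
  by do 3!case: (odd _).
apply: eq_big => [S|S /andP[SU' iS]]; first by rewrite -subsetD1 setU1K.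
have SU : S \subset U by rewrite -(setU1K iU) subsetD1 SU'.
have -> : (i |: U) :\: S = i |: (U :\: S).
  by rewrite setDUl [[set i] :\: S](setDidPl _) // disjoints1.
rewrite [v i * _]mulrCA [LHS]mulrA -exprD /F1 /F2 -!mulrA.
congr (_ * _); apply: signr_even.
rewrite inv_setU1r ?inE ?(negPf iU) ?andbF //.
rewrite -(inv_set1C iS) (inv_set1_subset i SU) !oddD.
by do 4!case: (odd _).
Qed.

(** With x' = x + d a and y' = y + d b, the product x y differs from x' y' by
    the boundary of x' b - a y, up to signs. *)
Lemma homologous_mul0 x x' y y' :
    d x' = 0 -> d y = 0 -> homologous v x' x -> homologous v y' y ->
  kmul x' y' = 0 -> homologous v (kmul x y) 0.
Proof.
move=> dx' dy [a xa] [b yb] xy0.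
exists (kmul (kbar x') b - kmul a y); rewrite subr0 kdiffB !kdiff_mul.
rewrite kdiff_bar dx' dy kbar0 oppr0 kmul0l kmul0r kbarK sub0r subr0 -xa -yb.
by rewrite kmulBl kmulBr xy0 sub0r opprK opprB addrC subrK.
Qed.

End KoszulAlgebra.

(** * Contraction of the Koszul complex of a polynomial ring *)

Section Homotopy.
Variables (k : fieldType) (T : finType).
Local Notation P := {mpoly k[#|T|]}.
Local Notation mon := 'X_{1..#|T|}.
Implicit Types (i j : T) (S U : {set T}) (m : mon) (z : koszul T P) (f : P).
Local Notation e i := U_(enum_rank i)%MM.
Local Notation d := (kdiff (srX k (V := T))).

Definition msupport m : {set T} := [set i | m (enum_rank i) != 0%N].

Lemma mcoeff_signM s f m : ((-1) ^+ s * f)@_m = (-1) ^+ s * f@_m.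
Proof.
by rewrite -signr_odd -[in RHS]signr_odd; case: (odd s);
  rewrite ?mulN1r ?mcoeffN ?mul1r.
Qed.

Lemma mcoeff_srXM i f m :
  (srX k i * f)@_m = if i \in msupport m then f@_(m - e i) else 0.
Proof.
rewrite inE mulrC; case: ifPn => [mi|].
  by rewrite -[in LHS](submK (m := e i) (m' := m)) ?lep1mP // addmC mcoeffMX.
apply: contraNeq; rewrite -mcoeff_msupp (perm_mem (msuppMX _ _)).
by case/mapP=> m' _ ->; rewrite mnmDE mnm1E eqxx.
Qed.

Lemma mcoeff_kdiff z S m :
  (d z S)@_m = \sum_(i | (i \notin S) && (i \in msupport m))
     (-1) ^+ inv [set i] S * (z (i |: S))@_(m - e i).
Proof.
rewrite ffunE raddf_sum /= big_mkcondr; apply: eq_bigr => i iS.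
by rewrite mcoeff_signM mcoeff_srXM; case: ifP; rewrite ?mulr0.
Qed.

Lemma mcoeff_kdiff_neq0 z S m : (d z S)@_m != 0 ->
  exists i, [/\ i \notin S, i \in msupport m & (z (i |: S))@_(m - e i) != 0].
Proof.
move=> nz; apply/not_existsP => H; case/eqP: nz; rewrite mcoeff_kdiff.
apply: big1 => i /andP[iS im]; have [z0|nz] := eqVneq (z (i |: S))@_(m - e i) 0.
  by rewrite z0 mulr0.
by case: (H i).
Qed.

(** The sum is the quotient by the variable of [i] of the part of [f] on the
    monomials in [Q], all of which that variable divides. *)
Lemma mcoeff_div i (Q : pred mon) f m :
    (forall m', Q m' -> i \in msupport m') ->
  (\sum_(m' <- msupp f | Q m') f@_m' *: 'X_[m' - e i])@_m =
    if Q (m + e i)%MM then f@_(m + e i) else 0.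
Proof.
move=> Qi; rewrite raddf_sum /= [X in if _ then X else _](congr1 _ (mpolyE f)).
rewrite raddf_sum /= big_mkcond /=.
rewrite (_ : (if _ then _ else _) = \sum_(m' <- msupp f)
   if Q (m + e i)%MM then (f@_m' *: 'X_[m'])@_(m + e i) else 0); last first.
  by case: ifP => // _; rewrite big1.
apply: eq_bigr => m' _; rewrite !mcoeffZ !mcoeffX.
have [->|ne] := eqVneq m' (m + e i)%MM; first by rewrite addmK eqxx.
rewrite mulr0 if_same; case: ifP => // /Qi; rewrite inE -lep1mP => le.
have [E|_] := eqVneq (m' - e i)%MM m; last by rewrite mulr0.
by rewrite -E submK ?eqxx in ne.
Qed.

Lemma msupport_eq0 m : (msupport m == set0) = (m == 0%MM).
Proof.
apply/eqP/eqP=> [m0|->]; last by apply/setP=> i; rewrite !inE mnm0E.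
apply/mnmP=> l; rewrite mnm0E -(enum_valK l); apply/eqP.
by have := in_set0 (enum_val l); rewrite -m0 inE => /negbFE.
Qed.

(** The set of variables of the multidegree of the basis element x^m u_S is
    [S :|: msupport m]. This lemma and the next say that d and the contraction
    preserve it, so that both use the same selected variable. *)
Lemma msupport_shift i S m : i \notin S -> i \in msupport m ->
  (i |: S) :|: msupport (m - e i) = S :|: msupport m.
Proof.
move=> iS im; apply/setP=> j; rewrite !inE mnmBE mnm1E (inj_eq enum_rank_inj).
case: (eqVneq j i) => [->|ji] /=; first by move: im; rewrite inE => ->; rewrite orbT.
by rewrite subn0.
Qed.

Lemma msupport_unshift j S m : j \in S ->
  (S :\ j) :|: msupport (m + e j) = S :|: msupport m.
Proof.
move=> jS; apply/setP=> i; rewrite !inE mnmDE mnm1E (inj_eq enum_rank_inj).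
by case: (eqVneq i j) => [->|ij] /=; rewrite ?jS ?addn1 // addn0.
Qed.

Variable sel : {set T} -> option T.
Hypothesis sel_mem : forall U j, sel U = Some j -> j \in U.
Hypothesis sel_none : forall U, sel U = None -> U = set0.

(** It sends x^m u_S to (x^m / x_j) u_j u_S, where j is the variable that [sel]
    chooses in the multidegree of x^m u_S; this is 0 if j is in S, and otherwise
    x_j divides x^m. So the coefficient of the image at u_S comes from the
    coefficients of z at the u_T with T = S minus j, for j in S. *)
Definition kcontract z : koszul T P :=
  [ffun S : {set T} => \sum_(j in S) (-1) ^+ inv [set j] (S :\ j) *
     \sum_(m <- msupp (z (S :\ j)) | sel ((S :\ j) :|: msupport m) == Some j)
        (z (S :\ j))@_m *: 'X_[m - e j]].

Lemma mcoeff_kcontract z S m : (kcontract z S)@_m =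
  \sum_(j in S | sel (S :|: msupport m) == Some j)
     (-1) ^+ inv [set j] (S :\ j) * (z (S :\ j))@_(m + e j).
Proof.
rewrite ffunE raddf_sum /= [RHS]big_mkcondr; apply: eq_bigr => j jS.
rewrite mcoeff_signM mcoeff_div; last first.
  by move=> m' /eqP/sel_mem; rewrite !inE eqxx.
by rewrite msupport_unshift //; case: ifP; rewrite ?mulr0.
Qed.

Lemma mcoeff_kcontractE z S m j : sel (S :|: msupport m) = Some j ->
  (kcontract z S)@_m =
    if j \in S then (-1) ^+ inv [set j] (S :\ j) * (z (S :\ j))@_(m + e j) else 0.
Proof.
move=> selj; rewrite mcoeff_kcontract selj.
case: ifPn => jS; last first.
  by rewrite big1 // => i /andP[iS /eqP[ji]]; rewrite ji iS in jS.
apply: big_pred1 => i /=; rewrite (inj_eq Some_inj) eq_sym andb_idl //.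
by move/eqP->.
Qed.

Lemma mcoeff_kcontract_neq0 z S m : (kcontract z S)@_m != 0 ->
  exists j, [/\ j \in S, sel (S :|: msupport m) = Some j
               & (z (S :\ j))@_(m + e j) != 0].
Proof.
case selU: (sel (S :|: msupport m)) => [j|]; last first.
  by rewrite mcoeff_kcontract selU big1 ?eqxx // => i /andP[].
rewrite (mcoeff_kcontractE _ selU); case: ifPn => jS; last by rewrite eqxx.
by rewrite mulf_eq0 signr_eq0 => nz; exists j.
Qed.

(** In a multidegree with selected variable j, this is the usual homotopy of the
    Koszul complex of the single element x_j, tensored with the Koszul complex of
    the other variables, whose differential anticommutes with u_j. *)
Lemma kcontract_homotopy z S m :
  (d (kcontract z) S)@_m + (kcontract (d z) S)@_m =
    if S :|: msupport m == set0 then 0 else (z S)@_m.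
Proof.
case: ifPn.
  rewrite setU_eq0 => /andP[/eqP-> /eqP m0].
  rewrite mcoeff_kdiff mcoeff_kcontract !big_pred0 ?addr0 // => i.
    by rewrite !inE.
  by rewrite m0 !inE.
case selU: (sel (S :|: msupport m)) => [j|]; last by rewrite (sel_none selU) eqxx.
move=> _; have jU := sel_mem selU.
rewrite (mcoeff_kcontractE _ selU) mcoeff_kdiff.
under eq_bigr => i /andP[iS im].
  rewrite (@mcoeff_kcontractE _ _ _ j) ?msupport_shift //; over.
case: ifPn => jS; last first.
  have jm : j \in msupport m by move: jU; rewrite inE (negPf jS).
  rewrite (bigD1 j) ?jS //= setU11 setU1K // submK; last by move: jm; rewrite inE lep1mP.
  rewrite signrMK big1 ?addr0 //.
  by move=> i /andP[_ ij]; rewrite in_setU1 eq_sym (negPf ij) (negPf jS) mulr0.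
rewrite mcoeff_kdiff [X in _ + _ * X](bigD1 j) /=; last first.
  by rewrite !inE eqxx mnmDE mnm1E eqxx addn1.
rewrite setD1K // addmK mulrDr signrMK.
rewrite addrCA mulr_sumr.
rewrite [X in _ + (_ + X)]
  (eq_bigl (fun i => (i \notin S) && (i \in msupport m))); last first.
  move=> i; rewrite !inE mnmDE mnm1E (inj_eq enum_rank_inj) eq_sym.
  by case: (eqVneq i j) => [->|ij]; rewrite ?jS ?andbF //= andbT addn0.
rewrite -big_split big1 ?addr0 //= => i /andP[iS im].
have ij : i != j by apply: contraNneq iS => ->.
rewrite in_setU1 jS orbT.
have -> : (i |: S) :\ j = i |: (S :\ j).
  by rewrite setDUl [[set i] :\ j](setDidPl _) // disjoints1 inE.
have -> : (m - e i + e j)%MM = (m + e j - e i)%MM.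
  by rewrite addmC addmBA ?[(e j + m)%MM]addmC //; move: im; rewrite inE lep1mP.
apply/eqP; rewrite !mulrA -!exprD addr_eq0 -mulNr; apply/eqP; congr (_ * _).
apply: signrN_odd; rewrite -{1}(setD1K jS).
rewrite [inv [set i] (j |: _)]inv_setU1r ?setD11 // inv_setU1r ?inE ?(negPf iS) ?andbF //.
have /(congr1 odd) := inv1C ij; rewrite /= !oddD.
by do 4!case: (odd _).
Qed.

End Homotopy.

(** * Monomials of the Stanley-Reisner ideal *)

Section StanleyReisnerMonomials.
Variables (k : fieldType) (T : finType) (M : scomplex T).
Implicit Types (f : {mpoly k[#|T|]}) (S : {set T}) (m : 'X_{1..#|T|}).
Local Notation proj := (sr_proj k M).

Lemma sr_proj_eq0 f : (proj f == 0) = sr_ideal M f.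
Proof.
rewrite -[in RHS](subr0 f); rewrite -[0](rmorph0 proj).
rewrite -[RHS]/(_ \in (sr_ideal M : idealr {mpoly k[#|T|]})).
by rewrite Quotient.idealrBE.
Qed.

Lemma sr_genE S : sr_gen k S = 'X_[\sum_(i in S) U_(enum_rank i)].
Proof. by rewrite /sr_gen /srX mprodXE. Qed.

Lemma squarefree_exponent S j :
  ((\sum_(i in S) U_(enum_rank i))%MM : 'X_{1..#|T|}) (enum_rank j) = (j \in S).
Proof.
rewrite mnm_sumE (eq_bigr (fun i => (i == j : nat))); last first.
  by move=> i _; rewrite mnm1E (inj_eq enum_rank_inj).
have [jS|jS] := boolP (j \in S).
  by rewrite (bigD1 j) //= eqxx big1 // => i /andP[_ /negPf->].
by apply: big1 => i iS; case: eqP jS => // <-; rewrite iS.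
Qed.

Lemma sr_gen_dvd S m : (S \subset msupport m) =
  ((\sum_(i in S) U_(enum_rank i))%MM <= m)%MM.
Proof.
apply/subsetP/mnm_lepP => [Sm l|le_m i iS]; last first.
  by have := le_m (enum_rank i); rewrite squarefree_exponent iS inE lt0n.
rewrite -(enum_valK l) squarefree_exponent.
by have [/Sm|//] := boolP (enum_val l \in S); rewrite inE lt0n.
Qed.

(** An ideal generated by monomials consists of the polynomials all of whose
    monomials belong to it; this lemma and the next are the two directions. *)
Lemma sr_proj_nonface f :
  (forall m, m \in msupp f -> msupport m \notin faces M) -> proj f = 0.
Proof.
move=> fM; rewrite [f]mpolyE big_seq rmorph_sum big1 // => m mf.
have := sr_gen_dvd (msupport m) m; rewrite subxx => /esym/submK.
rewrite -mul_mpolyC => <-; rewrite mpolyXD -sr_genE !rmorphM /=.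
suff -> : proj (sr_gen k (msupport m)) = 0 by rewrite !mulr0.
apply/eqP; rewrite sr_proj_eq0; apply/asboolP.
exists (fun S => (S == msupport m)%:R).
rewrite (bigD1 (msupport m)) ?fM //= eqxx mul1r big1 ?addr0 // => S /andP[_ /negPf->].
by rewrite mul0r.
Qed.

Lemma sr_proj0_nonface f m :
  proj f = 0 -> m \in msupp f -> msupport m \notin faces M.
Proof.
move=> /eqP; rewrite sr_proj_eq0 => /asboolP[c ->] /msupp_sum_le /flattenP[s].
case/mapP=> S; rewrite mem_filter => /andP[SM _] -> /msuppM_le /allpairsP[[m1 m2]] /=.
rewrite sr_genE msuppX inE => -[_ /eqP-> ->].
apply: contra SM => mM; apply: scomplexS mM _.
by rewrite sr_gen_dvd lem_addl.
Qed.

End StanleyReisnerMonomials.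

(** * Products of ideals in disjoint sets of variables *)

Section ProductIdeal.
Variables (k : fieldType) (T : finType) (M : scomplex T).
Implicit Types (F G : {set {set T}}) (B S U : {set T}).
Local Notation P := {mpoly k[#|T|]}.
Local Notation A := (koszul T (sr_ring k M)).
Local Notation proj := (sr_proj k M).
Local Notation d := (kdiff (srx k M)).

Definition coef_in F (x : A) : Prop := forall S : {set T},
  exists2 f : P, x S = proj f &
    forall m, m \in msupp f -> exists2 s, s \in F & s \subset msupport m.

Lemma coef_in_bar F x : coef_in F x -> coef_in F (kbar x).
Proof.
move=> xF S; have [f fE fF] := xF S.
exists ((-1) ^+ #|S|.+1 * f); first by rewrite ffunE fE rmorphMsign.
move=> m; rewrite mcoeff_msupp mcoeff_signM mulf_eq0 signr_eq0 -mcoeff_msupp.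
exact: fF.
Qed.

Lemma kmul_coef_in F G x y :
    (forall s t, s \in F -> t \in G -> s :|: t \notin faces M) ->
  coef_in F x -> coef_in G y -> kmul x y = 0.
Proof.
move=> FG xF yG; apply/ffunP=> U; rewrite !ffunE big1 // => S _.
have [f -> fF] := xF S; have [g -> gG] := yG (U :\: S).
rewrite -rmorphM /= sr_proj_nonface ?mulr0 // => m /msuppM_le /allpairsP[[m1 m2]] /=.
case=> /fF[s sF sm1] /gG[t tG tm2] ->.
apply: contra (FG s t sF tG) => mM; apply: scomplexS mM _.
rewrite subUset; apply/andP; split; apply/subsetP=> i.
  by move/(subsetP sm1); rewrite !inE mnmDE addn_eq0 negb_and => ->.
by move/(subsetP tm2); rewrite !inE mnmDE addn_eq0 negb_and => ->; rewrite orbT.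
Qed.

Definition kproj (x : koszul T P) : A := [ffun S : {set T} => proj (x S)].

Lemma kprojB x y : kproj (x - y) = kproj x - kproj y.
Proof. by apply/ffunP=> S; rewrite !ffunE rmorphB. Qed.

Lemma kdiff_proj x : d (kproj x) = kproj (kdiff (srX k (V := T)) x).
Proof.
apply/ffunP=> S; rewrite !ffunE rmorph_sum; apply: eq_bigr => i _.
by rewrite rmorphMsign rmorphM ffunE.
Qed.

(** Prefers the elements of [B]; as a choice of variables for the contraction, it
    makes every monomial that involves [B] be divided by a variable in [B]. *)
Definition select B U : option T :=
  if [pick j in U :&: B] is Some j then Some j else [pick j in U].

Lemma select_mem B U j : select B U = Some j -> j \in U.
Proof.
rewrite /select; case: pickP => [i|_]; first by rewrite inE => /andP[iU _] [<-].
by case: pickP => // i iU [<-].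
Qed.

Lemma select_none B U : select B U = None -> U = set0.
Proof.
rewrite /select; case: pickP => // _; case: pickP => // U0 _.
by apply/setP=> i; rewrite inE U0.
Qed.

Lemma select_pref B U i j : i \in U :&: B -> select B U = Some j -> j \in B.
Proof.
rewrite /select; case: pickP => [l|->//]; by rewrite inE => /andP[_ lB] _ [<-].
Qed.

(** The lift y of the cycle z has d y in the ideal of non-faces, and
    y - d (H y) = H (d y) for the contraction H that prefers the variables in B.
    A monomial of d y involves B because it is divisible by some t in G; so H
    divides it by a variable in B, and it remains divisible by some s in F. The
    multidegree 0, where H contracts nothing, is excluded by the positivity of
    the degree. *)
Lemma coef_in_representative F G B p r z :
    (forall s, s \in F -> [disjoint s & B]) ->
    (forall t, t \in G -> t != set0 /\ t \subset B) ->
    (forall u, u \notin faces M ->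
       (exists2 s, s \in F & s \subset u) /\ (exists2 t, t \in G & t \subset u)) ->
    pos_cycle p r z ->
  exists z', [/\ kbideg p r z', d z' = 0, homologous (srx k M) z' z & coef_in F z'].
Proof.
move=> FB GB FG [zpr pr_gt0 dz0].
have /choice[zt ztP] : forall S : {set T}, exists f : P, z S = proj f /\
    forall m, m \in msupp f -> #|S| = p /\ (2 * (#|S| + mdeg m))%N = r.
  by move=> S; have [f] := zpr S; exists f.
pose y : koszul T P := [ffun S => zt S].
have zE : z = kproj y.
  by apply/ffunP=> S; rewrite !ffunE; have [] := ztP S.
have ydeg S m : (y S)@_m != 0 -> #|S| = p /\ (2 * (#|S| + mdeg m))%N = r.
  by rewrite ffunE -mcoeff_msupp; have [_] := ztP S; apply.
pose dX := kdiff (srX k (V := T)).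
pose w := kcontract (select B) y.
have dy_nonface S m : (dX y S)@_m != 0 -> msupport m \notin faces M.
  rewrite -mcoeff_msupp; apply: sr_proj0_nonface.
  by move: dz0; rewrite zE kdiff_proj => /ffunP/(_ S); rewrite !ffunE.
have y_constant S m : S :|: msupport m == set0 -> (y S)@_m = 0.
  rewrite setU_eq0 msupport_eq0 => /andP[/eqP-> /eqP->]; apply/eqP/contraT => /ydeg.
  by rewrite cards0 mdeg0 => -[p0 r0]; rewrite -p0 -r0 in pr_gt0.
have yw S m : ((y - dX w) S)@_m = (kcontract (select B) (dX y) S)@_m.
  have := kcontract_homotopy (@select_mem B) (@select_none B) y S m.
  have -> : (if S :|: msupport m == set0 then 0 else (y S)@_m) = (y S)@_m.
    by case: ifP => // /y_constant->.
  rewrite -/dX -/w [(y - _) S]ffunE [(- dX w) S]ffunE mcoeffB => <-.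
  by rewrite addrC addKr.
exists (kproj (y - dX w)); split.
- move=> S; exists ((y - dX w) S); first by rewrite !ffunE.
  move=> m; rewrite mcoeff_msupp yw => /(mcoeff_kcontract_neq0 (@select_mem B))[j [jS _]].
  case/mcoeff_kdiff_neq0 => i [iS im] /ydeg; rewrite cardsU1 iS (cardsD1 j S) jS.
  have -> // : mdeg (m + U_(enum_rank j) - U_(enum_rank i)) = mdeg m.
  apply: (@addIn (mdeg U_(enum_rank i))); rewrite -mdegD submK ?mdegD ?mdeg1 //.
  by move: im; rewrite inE lep1mP.
- by rewrite kprojB -zE -kdiff_proj kdiffB dz0 kdiffK subr0.
- exists (- kproj w); rewrite kprojB -zE kdiffN kdiff_proj.
  by rewrite addrAC subrr add0r.
- move=> S; exists ((y - dX w) S); first by rewrite !ffunE.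
  move=> m; rewrite mcoeff_msupp yw.
  move=> /(mcoeff_kcontract_neq0 (@select_mem B))[j [jS selj /dy_nonface/FG[]]].
  move=> [s sF sm] [t tG tm]; exists s => //.
  have [/set0Pn[i it] tB] := GB t tG.
  have im : i \in (S :|: msupport m) :&: B.
    by rewrite inE (subsetP tB) // andbT -(msupport_unshift m jS) inE (subsetP tm) ?orbT.
  have jB := select_pref im selj.
  apply/subsetP=> l ls; have lj : l != j.
    apply: contraTneq jB => <-; by rewrite (disjointFr (FB s sF) ls).
  have := subsetP sm l ls; rewrite !inE mnmDE mnm1E (inj_eq enum_rank_inj).
  by rewrite [j == l]eq_sym (negPf lj) addn0.
Qed.

(** The hypotheses say that the Stanley-Reisner ideal is the product of the
    ideals generated by F and by G, which involve disjoint sets of variables. The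
    members are nonempty to make both ideals proper: with G = {set0} and B empty,
    every complex would qualify. *)
Theorem golod_product_ideal F G B :
    (forall s, s \in F -> s != set0 /\ s \subset ~: B) ->
    (forall t, t \in G -> t != set0 /\ t \subset B) ->
    (forall u, u \notin faces M ->
       (exists2 s, s \in F & s \subset u) /\ (exists2 t, t \in G & t \subset u)) ->
    (forall s t, s \in F -> t \in G -> s :|: t \notin faces M) ->
  golod_over k M.
Proof.
move=> FB GB FG prodFG.
have repF p r z : pos_cycle p r z -> exists z',
    [/\ kbideg p r z', d z' = 0, homologous (srx k M) z' z & coef_in F z'].
  apply: coef_in_representative GB FG => s /FB[_].
  by rewrite disjoints_subset.
have repG p r z : pos_cycle p r z -> exists z',
    [/\ kbideg p r z', d z' = 0, homologous (srx k M) z' z & coef_in G z'].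
  apply: coef_in_representative FB _ => [t /GB[_]|u /FG[]//].
  by rewrite disjoints_subset setCK.
split=> [p r p' r' x y /repF[x' [_ dx' xx' x'F]] y_cycle|n p r z n_gt2 z_cycle].
  have [y' [_ dy' yy' y'G]] := repG _ _ _ y_cycle; have [_ _ dy] := y_cycle.
  exact: homologous_mul0 dx' dy xx' yy' (kmul_coef_in prodFG x'F y'G).
have /choice[b bP] : forall i, exists b : A, (1 <= i <= n)%N ->
    [/\ kbideg (p i) (r i) b, d b = 0, homologous (srx k M) b (z i)
      & coef_in (if odd i then F else G) b].
  move=> i; case: (boolP (1 <= i <= n)%N) => [/z_cycle zi|_]; last by exists 0.
  by case: (odd i); [have [b] := repF _ _ _ zi | have [b] := repG _ _ _ zi]; exists b.
have bb0 i : (1 <= i < n)%N -> kmul (kbar (b i)) (b i.+1) = 0.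
  move=> /andP[i1 iN].
  have [_ _ _ bi] := bP i (introT andP (conj i1 (ltnW iN))).
  have [_ _ _ bi1] := bP i.+1 (introT andP (conj (ltn0Sn i) iN)).
  move: bi => /coef_in_bar; move: bi1 => /=; case: (odd i) => /= bi1 bi.
    exact: kmul_coef_in bi bi1.
  by apply: kmul_coef_in bi bi1 => s t sG tF; rewrite setUC prodFG.
pose a i j : A := if i == j then b i else 0.
have ab i j : (1 <= i)%N -> (j <= n)%N -> (i < j)%N ->
    \sum_(i <= l < j) kmul (kbar (a i l)) (a l.+1 j) = 0.
  move=> i1 jn ij; rewrite big_nat_cond big1 // => l /andP[/andP[il lj] _].
  rewrite /a; case: eqVneq => [<-|_]; last by rewrite kbar0 kmul0l.
  case: eqVneq => [E|_]; last by rewrite kmul0r.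
  by rewrite bb0 // i1 (leq_trans ij).
exists a; split.
- by move=> i iN; rewrite /a eqxx; have [_ ? ? _] := bP i iN.
- move=> i j /andP[i1 ij] jn _; rewrite /a; case: eqVneq => [<-|_].
    rewrite !big_nat1 subnn addn0.
    by have [|? _ _ _] := bP i => //; rewrite i1 (leq_trans ij).
  by move=> S; exists 0; rewrite ?ffunE ?rmorph0 // => m; rewrite msupp0.
- by move=> i j /andP[i1 ij] jn _; rewrite ab // /a ltn_eqF // kdiff0.
- exists 0; rewrite ab ?subrr ?kdiff0 //; exact: ltnW.
Qed.

End ProductIdeal.

(** * Duals of joins *)

Theorem corollary2p4 (V W : finType) (K : scomplex V) (L : scomplex W)
    (hK : K != simplex V) (hL : L != simplex W) :
  golod (alexander_dual (join_neq_simplex hK hL)).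
Proof.
move=> k.
(* The minimal generators are the complements of facets; all complements of
   faces generate the same ideals. *)
pose F : {set {set V + W}} := [set inl @: (~: s) | s : {set V} in K].
pose G : {set {set V + W}} := [set inr @: (~: t) | t : {set W} in L].
have compl_neq0 (X : finType) (N : scomplex X) s :
    N != simplex X -> s \in faces N -> ~: s != set0.
  rewrite neq_simplex => NT; apply: contraTneq => s0.
  by rewrite -[s]setCK s0 setC0.
apply: (@golod_product_ideal _ _ _ F G [set x | if x is inr _ then true else false]).
- move=> _ /imsetP[s sK ->]; rewrite imset_eq0 (compl_neq0 _ K) //; split=> //.
  by apply/subsetP=> _ /imsetP[i _ ->]; rewrite !inE.
- move=> _ /imsetP[s sL ->]; rewrite imset_eq0 (compl_neq0 _ L) //; split=> //.
  by apply/subsetP=> _ /imsetP[i _ ->]; rewrite !inE.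
- move=> u; rewrite inE negbK in_join_faces => /andP[uK uL]; split.
    exists (inl @: (~: (inl @^-1: ~: u))); first exact: imset_f.
    by apply/subsetP=> _ /imsetP[i iu ->]; move: iu; rewrite !inE negbK.
  exists (inr @: (~: (inr @^-1: ~: u))); first exact: imset_f.
  by apply/subsetP=> _ /imsetP[i iu ->]; move: iu; rewrite !inE negbK.
- move=> _ _ /imsetP[s sK ->] /imsetP[t tL ->].
  rewrite inE negbK in_join_faces; apply/andP; split.
    apply: scomplexS sK _; apply/subsetP=> i; rewrite !inE negb_or => /andP[+ _].
    by rewrite mem_imset ?inE ?negbK // => ? ? [].
  apply: scomplexS tL _; apply/subsetP=> i; rewrite !inE negb_or => /andP[_].
  by rewrite mem_imset ?inE ?negbK // => ? ? [].
Qed.
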